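(* Let $I$ be a set of indices, let $(P_i)_{i\in I}$ be sets, let $\mathrm{Exc}$ be a set and let $t_i:P_i\to\mathrm{Exc}$ ($i\in I$) be injective functions such that $\mathrm{Exc}$ is the disjoint union of the images $E_i=t_i(P_i)$. Consider the decorated theory $\mathcal{T}_{\mathrm{exc}}$ (in sets) and the decorated specification for exceptions $\mathcal{S}_{\mathrm{exc}}$ described in the context. Then mapping every feature of $\mathcal{S}_{\mathrm{exc}}$ to the feature with the same name in $\mathcal{T}_{\mathrm{exc}}$ gives a model of $\mathcal{S}_{\mathrm{exc}}$ with values in $\mathcal{T}_{\mathrm{exc}}$: each pure operation goes to the corresponding function, the empty type $\mathbb{0}$ goes to $\emptyset$, $t_i$ goes to the tagging function $t_i$, $c_i$ goes to the untagging function $c_i$, and the specified weak equations $c_i\circ t_i\sim \mathrm{id}_{P_i}$ and $c_i\circ t_j\sim [\,]_{P_i}\circ t_j$ ($j\neq i$) hold; moreover the interpretations of the raising propagators $\mathrm{throw}_i^Y$ and of the handling propagators $\mathrm{try}(f)\,\mathrm{catch}\{i_1\Rightarrow g_1|\dots|i_n\Rightarrow g_n\}$, as defined in the decorated specification, are exactly the denotational raising and handling functions described in the context. In this sense $\mathcal{S}_{\mathrm{exc}}$ is sound with respect to the denotational semantics of exceptions.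
   Context: Denotational semantics. For a set $X$ write $X+\mathrm{Exc}$ for the disjoint union with inclusions $\mathrm{in}_X:X\to X+\mathrm{Exc}$, $\mathrm{in}'_X:\mathrm{Exc}\to X+\mathrm{Exc}$. For $f:X\to Y+\mathrm{Exc}$, $[f|\mathrm{in}'_Y]:X+\mathrm{Exc}\to Y+\mathrm{Exc}$ is the unique map equal to $f$ on $X$ and to $\mathrm{in}'_Y$ on $\mathrm{Exc}$. The untagging function $c_i:\mathrm{Exc}\to P_i+\mathrm{Exc}$ is defined by $c_i(t_i(a))=a$ for $a\in P_i$ and $c_i(t_j(b))=t_j(b)$ for $b\in P_j$, $j\ne i$. The raising function is $\mathrm{throw}_i^Y=\mathrm{in}'_Y\circ t_i:P_i\to Y+\mathrm{Exc}$. For $f:X\to Y+\mathrm{Exc}$, a non-empty list $(i_1,\dots,i_n)$ of indices and $g_k:P_{i_k}\to Y+\mathrm{Exc}$, the handling function is $h=[\mathrm{in}_Y\,|\,k_1]\circ f:X\to Y+\mathrm{Exc}$, where $k_{n+1}=\mathrm{in}'_Y$ and $k_p=[g_p\,|\,k_{p+1}]\circ c_{i_p}:\mathrm{Exc}\to Y+\mathrm{Exc}$ for $p=n,\dots,1$ (here $[u|v]$ denotes copairing out of a disjoint union); i.e. if $f(x)\in Y$ the result is $f(x)$, if $f(x)$ is an exception in $E_{i_k}$ with $k$ the first index of the list with that type it is $g_k$ applied to its parameter, and otherwise the exception is propagated. Decorated theory $\mathcal{T}_{\mathrm{exc}}$: types are sets; a pure expression $X\to Y$ is a function $X\to Y$;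 a propagator $X\to Y$ is a function $X\to Y+\mathrm{Exc}$; a catcher $X\to Y$ is a function $X+\mathrm{Exc}\to Y+\mathrm{Exc}$. A pure $f_0$ is viewed as the propagator $\mathrm{in}_Y\circ f_0$, a propagator $f_1$ as the catcher $[f_1|\mathrm{in}'_Y]$; composition is composition of the associated catchers. A strong equation $f\equiv g$ means equality on all of $X+\mathrm{Exc}$; a weak equation $f\sim g$ means equality on $X$ (ordinary values). For a catcher $k$, $k^\natural$ is the propagator equal to $k$ on $X$ (and to the identity on exceptions). The empty type is $\emptyset$ with $[\,]_X:\emptyset\to X$ the empty function. For a propagator $g:X\to Y$ and a catcher $k:\emptyset\to Y$ (i.e. a function $\mathrm{Exc}\to Y+\mathrm{Exc}$), $[g|k]$ is the catcher equal to $g$ on $X$ and to $k$ on $\mathrm{Exc}$. Decorated specification $\mathcal{S}_{\mathrm{exc}}$: a fixed equational specification $\mathcal{S}_{\mathrm{pure}}$ (constants and unary operations only) whose operations are decorated pure and equations strong; an empty type $\mathbb{0}$; for each $i\in I$ a type $P_i$ of $\mathcal{S}_{\mathrm{pure}}$, a propagator $t_i:P_i\to\mathbb{0}$, a catcher $c_i:\mathbb{0}\to P_i$ with weak equations $c_i\circ t_i\sim\mathrm{id}_{P_i}$ and $c_i\circ t_j\sim[\,]_{P_i}\circ t_j$ for $j\ne i$. In it, $\mathrm{throw}_i^Y=[\,]_Y\circ t_i:P_i\to Y$ (propagator), and for a propagator $f:X\to Y$, non-empty list $(i_1,\dots,i_n)$ and propagators $g_k:P_{i_k}\to Y$: $k_{n+1}=[\,]_Y$,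 $k_p=[g_p|k_{p+1}]\circ c_{i_p}:\mathbb{0}\to Y$, $H=[\mathrm{id}_Y|k_1]\circ f$, and $\mathrm{try}(f)\,\mathrm{catch}\{i_1\Rightarrow g_1|\dots|i_n\Rightarrow g_n\}=H^\natural$ (propagator). *)

(* Defs.v *)
(* Sets are types, and equality of functions is pointwise. *)
From Stdlib Require Import List ClassicalEpsilon.
Import ListNotations.

Set Implicit Arguments.
Unset Strict Implicit.
Unset Printing Implicit Defensive.

Inductive decoration := Pure | Propagator | Catcher.

Inductive strength := Strong | Weak.

Definition hom (Exc : Type) (d : decoration) (X Y : Type) : Type :=
  match d with
  | Pure => X -> Y
  | Propagator => X -> Y + Exc
  | Catcher => X + Exc -> Y + Exc
  end.

Definition copairing (A B C : Type) (f : A -> C) (g : B -> C) (x : A + B) : C :=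
  match x with
  | inl a => f a
  | inr b => g b
  end.

Definition ppg_of_pure (Exc X Y : Type) (f : hom Exc Pure X Y) :
    hom Exc Propagator X Y :=
  fun x => inl (f x).

Definition ctc_of_ppg (Exc X Y : Type) (f : hom Exc Propagator X Y) :
    hom Exc Catcher X Y :=
  copairing f inr.

(* In each of the first two cases the catcher associated with the composite is
   the composite of the associated catchers. *)
Definition hom_comp (Exc : Type) (d : decoration) (X Y Z : Type) :
    hom Exc d Y Z -> hom Exc d X Y -> hom Exc d X Z :=
  match d return hom Exc d Y Z -> hom Exc d X Y -> hom Exc d X Z with
  | Pure => fun g f x => g (f x)
  | Propagator => fun g f x => ctc_of_ppg g (f x)
  | Catcher => fun g f x => g (f x)
  end.

Definition hom_id (Exc X : Type) : hom Exc Pure X X := fun x => x.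

Definition hom_empty (Exc X : Type) : hom Exc Pure Empty_set X :=
  fun x => match x with end.

Definition hom_unit (Exc X : Type) : hom Exc Pure X unit := fun _ => tt.

Arguments hom_id : clear implicits.
Arguments hom_empty : clear implicits.
Arguments hom_unit : clear implicits.

(* A catcher from the empty set is a function on [Empty_set + Exc], that is,
   up to the canonical bijection, a function on [Exc]. *)
Definition hom_case (Exc X Y : Type)
    (g : hom Exc Propagator X Y) (k : hom Exc Catcher Empty_set Y) :
    hom Exc Catcher X Y :=
  copairing g (fun e => k (inr e)).

Definition hom_natural (Exc X Y : Type) (k : hom Exc Catcher X Y) :
    hom Exc Propagator X Y :=
  fun x => k (inl x).

Definition holds (Exc : Type) (s : strength) (X Y : Type)
    (f g : hom Exc Catcher X Y) : Prop :=
  match s with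
  | Strong => forall x : X + Exc, f x = g x
  | Weak => forall x : X, f (inl x) = g (inl x)
  end.

Record pure_sig := PureSig {
  sort : Type;
  cst : sort -> Type;
  op : sort -> sort -> Type
}.

(* [term S G s]: terms of sort [s] which are closed when [G = None], and which
   may contain one variable, of sort [s'], when [G = Some s']. *)
Inductive term (S : pure_sig) : option (sort S) -> sort S -> Type :=
| TVar s : term (Some s) s
| TCst G s : cst s -> term G s
| TOp G s s' : op s s' -> term G s -> term G s'.

Record pure_spec := PureSpec {
  psig :> pure_sig;
  pure_axiom : forall (G : option (sort psig)) (s : sort psig),
    term G s -> term G s -> Prop
}.

Definition context (S : pure_sig) (C : sort S -> Type) (G : option (sort S)) :
    Type :=
  match G with
  | None => unit
  | Some s => C s
  end.

Fixpoint term_eval (S : pure_sig) (C : sort S -> Type)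
    (cv : forall s, cst s -> C s) (ov : forall s s', op s s' -> C s -> C s')
    (G : option (sort S)) (s : sort S) (u : term G s) {struct u} :
    context C G -> C s :=
  match u in term G s return context C G -> C s with
  | TVar _ => fun x => x
  | TCst _ c => fun _ => cv _ c
  | TOp f u' => fun x => ov _ _ f (term_eval cv ov u' x)
  end.

Record pure_model (S : pure_spec) := PureModel {
  carrier : sort S -> Type;
  cst_val : forall s, cst s -> carrier s;
  op_val : forall s s', op s s' -> carrier s -> carrier s';
  pure_axiom_val : forall G s (u v : term G s), pure_axiom u v ->
    forall x, term_eval cst_val op_val u x = term_eval cst_val op_val v x
}.

Arguments cst_val {S} _ [s] _.
Arguments op_val {S} _ [s s'] _ _.

(* [One] is the domain of the constants. *)
Inductive ty (S : pure_sig) := Zero | One | Base (s : sort S).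
Arguments Zero {S}.
Arguments One {S}.

(* [V] is a family of further propagator symbols, subject to no equation.  It
   stands for the programs [f], [g_k] from which handling expressions are built,
   which need not be definable from the features of the specification alone.
   The specification proper is the case where [V] is empty. *)
Inductive expr (S : pure_sig) (I : Type) (P : I -> sort S)
    (V : ty S -> ty S -> Type) : decoration -> ty S -> ty S -> Type :=
| EId X : expr P V Pure X X
| EComp d X Y Z : expr P V d Y Z -> expr P V d X Y -> expr P V d X Z
| EPpg X Y : expr P V Pure X Y -> expr P V Propagator X Y
| ECtc X Y : expr P V Propagator X Y -> expr P V Catcher X Y
| EUnit X : expr P V Pure X One
| ECst s : cst s -> expr P V Pure One (Base s)
| EOp s s' : op s s' -> expr P V Pure (Base s) (Base s')
| EEmpty X : expr P V Pure Zero X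
| ETag i : expr P V Propagator (Base (P i)) Zero
| EUntag i : expr P V Catcher Zero (Base (P i))
| EVar X Y : V X Y -> expr P V Propagator X Y
| ECase X Y : expr P V Propagator X Y -> expr P V Catcher Zero Y ->
    expr P V Catcher X Y
| ENatural X Y : expr P V Catcher X Y -> expr P V Propagator X Y.

Arguments EId {S I P V} X.
Arguments EUnit {S I P V} X.
Arguments ECst {S I P V s}.
Arguments EOp {S I P V s s'}.
Arguments EEmpty {S I P V} X.
Arguments ETag {S I P V} i.
Arguments EUntag {S I P V} i.
Arguments EVar {S I P V X Y}.

Definition ty_of_context (S : pure_sig) (G : option (sort S)) : ty S :=
  match G with
  | None => One
  | Some s => Base s
  end.

Fixpoint expr_of_term (S : pure_sig) (I : Type) (P : I -> sort S)
    (V : ty S -> ty S -> Type) (G : option (sort S)) (s : sort S)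
    (u : term G s) {struct u} : expr P V Pure (ty_of_context G) (Base s) :=
  match u in term G s return expr P V Pure (ty_of_context G) (Base s) with
  | TVar s => EId (Base s)
  | @TCst _ G _ c => EComp (ECst c) (EUnit (ty_of_context G))
  | TOp f u' => EComp (EOp f) (expr_of_term P V u')
  end.

Inductive exc_axiom (S : pure_spec) (I : Type) (P : I -> sort S)
    (V : ty S -> ty S -> Type) : strength ->
    forall X Y : ty S, expr P V Catcher X Y -> expr P V Catcher X Y -> Prop :=
| AxPure G s (u v : term G s) : pure_axiom u v ->
    exc_axiom Strong (ECtc (EPpg (expr_of_term P V u)))
                     (ECtc (EPpg (expr_of_term P V v)))
| AxUntagTag i :
    exc_axiom Weak (EComp (EUntag i) (ECtc (ETag i)))
                   (ECtc (EPpg (EId (Base (P i)))))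
| AxUntagOther i j : j <> i ->
    exc_axiom Weak (EComp (EUntag i) (ECtc (ETag j)))
                   (EComp (ECtc (EPpg (EEmpty (Base (P i))))) (ECtc (ETag j))).

Definition ethrow (S : pure_sig) (I : Type) (P : I -> sort S)
    (V : ty S -> ty S -> Type) (i : I) (Y : ty S) :
    expr P V Propagator (Base (P i)) Y :=
  EComp (EPpg (EEmpty Y)) (ETag i).

Definition eclause (S : pure_sig) (I : Type) (P : I -> sort S)
    (V : ty S -> ty S -> Type) (Y : ty S) : Type :=
  {i : I & expr P V Propagator (Base (P i)) Y}.

Fixpoint ehandlers (S : pure_sig) (I : Type) (P : I -> sort S)
    (V : ty S -> ty S -> Type) (Y : ty S) (gs : list (eclause P V Y)) :
    expr P V Catcher Zero Y :=
  match gs with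
  | [] => ECtc (EPpg (EEmpty Y))
  | existT _ i g :: gs' => EComp (ECase g (ehandlers gs')) (EUntag i)
  end.

Definition etry (S : pure_sig) (I : Type) (P : I -> sort S)
    (V : ty S -> ty S -> Type) (X Y : ty S) (f : expr P V Propagator X Y)
    (gs : list (eclause P V Y)) : expr P V Propagator X Y :=
  ENatural (EComp (ECase (EPpg (EId Y)) (ehandlers gs)) (ECtc f)).

Definition ty_val (S : pure_sig) (C : sort S -> Type) (X : ty S) : Type :=
  match X with
  | Zero => Empty_set
  | One => unit
  | Base s => C s
  end.

Record interpretation (Exc : Type) (S : pure_sig) (I : Type) (P : I -> sort S)
    (V : ty S -> ty S -> Type) := Interpretation {
  sort_int : sort S -> Type;
  cst_int : forall s, cst s -> hom Exc Pure unit (sort_int s);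
  op_int : forall s s', op s s' -> hom Exc Pure (sort_int s) (sort_int s');
  tag_int : forall i, hom Exc Propagator (sort_int (P i)) Empty_set;
  untag_int : forall i, hom Exc Catcher Empty_set (sort_int (P i));
  var_int : forall X Y, V X Y ->
    hom Exc Propagator (ty_val sort_int X) (ty_val sort_int Y)
}.

Arguments cst_int {Exc S I P V} _ [s] _.
Arguments op_int {Exc S I P V} _ [s s'] _.
Arguments tag_int {Exc S I P V} _ i _.
Arguments untag_int {Exc S I P V} _ i _.
Arguments var_int {Exc S I P V} _ [X Y] _.

Fixpoint eval (Exc : Type) (S : pure_sig) (I : Type) (P : I -> sort S)
    (V : ty S -> ty S -> Type) (M : interpretation Exc P V)
    (d : decoration) (X Y : ty S) (e : expr P V d X Y) {struct e} :
    hom Exc d (ty_val (sort_int M) X) (ty_val (sort_int M) Y) :=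
  match e in expr _ _ d X Y
    return hom Exc d (ty_val (sort_int M) X) (ty_val (sort_int M) Y) with
  | EId X => hom_id Exc _
  | EComp g f => hom_comp (eval M g) (eval M f)
  | EPpg f => ppg_of_pure (eval M f)
  | ECtc f => ctc_of_ppg (eval M f)
  | EUnit X => hom_unit Exc _
  | ECst c => cst_int M c
  | EOp f => op_int M f
  | EEmpty X => hom_empty Exc _
  | ETag i => tag_int M i
  | EUntag i => untag_int M i
  | EVar v => var_int M v
  | ECase g k => hom_case (eval M g) (eval M k)
  | ENatural k => hom_natural (eval M k)
  end.

Definition is_model (Exc : Type) (S : pure_spec) (I : Type) (P : I -> sort S)
    (V : ty S -> ty S -> Type) (M : interpretation Exc P V) : Prop :=
  forall (s : strength) (X Y : ty S) (f g : expr P V Catcher X Y),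
    exc_axiom s f g -> holds s (eval M f) (eval M g).

(* Membership of [e] in the image of [t i] is decided classically.  When the
   [t i] are injective and [Exc] is the disjoint union of their images, this is
   the only function satisfying [untag_same] and [untag_other] below. *)
Definition untag (Exc I : Type) (P : I -> Type) (t : forall i, P i -> Exc)
    (i : I) (e : Exc) : P i + Exc :=
  match excluded_middle_informative (exists a, t i a = e) with
  | left h => inl (proj1_sig (constructive_indefinite_description _ h))
  | right _ => inr e
  end.

Lemma untag_same (Exc I : Type) (P : I -> Type) (t : forall i, P i -> Exc)
    (t_inj : forall i a b, t i a = t i b -> a = b) (i : I) (a : P i) :
  untag t i (t i a) = inl a.
Proof.
unfold untag; destruct excluded_middle_informative as [h|h].
- f_equal; apply t_inj.
  exact (proj2_sig (constructive_indefinite_description _ h)).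
- destruct h; now exists a.
Qed.

Lemma untag_other (Exc I : Type) (P : I -> Type) (t : forall i, P i -> Exc)
    (t_disj : forall i j a b, t i a = t j b -> i = j)
    (i j : I) (b : P j) :
  j <> i -> untag t i (t j b) = inr (t j b).
Proof.
intros ne; unfold untag; destruct excluded_middle_informative as [[a ha]|h].
- destruct ne; symmetry; exact (t_disj _ _ _ _ ha).
- reflexivity.
Qed.

Definition throw (Exc I : Type) (P : I -> Type) (t : forall i, P i -> Exc)
    (i : I) (Y : Type) (a : P i) : Y + Exc :=
  inr (t i a).

Arguments throw {Exc I P} t i Y a.

Definition clause (Exc I : Type) (P : I -> Type) (Y : Type) : Type :=
  {i : I & P i -> Y + Exc}.

Fixpoint handlers (Exc I : Type) (P : I -> Type) (t : forall i, P i -> Exc)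
    (Y : Type) (gs : list (clause Exc P Y)) : Exc -> Y + Exc :=
  match gs with
  | [] => inr
  | existT _ i g :: gs' => fun e => copairing g (handlers t gs') (untag t i e)
  end.

Definition handle (Exc I : Type) (P : I -> Type) (t : forall i, P i -> Exc)
    (X Y : Type) (f : X -> Y + Exc) (gs : list (clause Exc P Y)) (x : X) :
    Y + Exc :=
  copairing inl (handlers t gs) (f x).

Definition exc_interpretation (Exc : Type) (S : pure_spec) (I : Type)
    (P : I -> sort S) (V : ty S -> ty S -> Type) (M : pure_model S)
    (t : forall i, carrier M (P i) -> Exc)
    (v : forall X Y, V X Y ->
      hom Exc Propagator (ty_val (carrier M) X) (ty_val (carrier M) Y)) :
    interpretation Exc P V :=
  {| sort_int := carrier M;
     cst_int := fun s c _ => cst_val M c;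
     op_int := fun s s' f => op_val M f;
     tag_int := fun i a => inr (t i a);
     untag_int := fun i =>
       copairing (fun z : Empty_set => match z with end) (untag t i);
     var_int := v |}.

Definition clause_val (Exc : Type) (S : pure_sig) (I : Type)
    (P : I -> sort S) (V : ty S -> ty S -> Type) (M : interpretation Exc P V)
    (Y : ty S) (c : eclause P V Y) :
    clause Exc (fun i => sort_int M (P i)) (ty_val (sort_int M) Y) :=
  existT _ (projT1 c) (eval M (projT2 c)).

(* Main.v *)
(* A pure term evaluates to the same function in the pure model and in the
   decorated theory, which gives the pure axioms; the untagging axioms are the
   characteristic equations of [untag].  A catcher out of the empty type is
   determined by its values on exceptions, and there the decorated chain of
   handlers unfolds to the denotational one. *)
Require Import Defs.
From Stdlib Require Import List.

Set Implicit Arguments.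
Unset Strict Implicit.
Unset Printing Implicit Defensive.

(** The two types become convertible only once [G] is a constructor, hence an identity map defined
    by cases. *)
Definition context_of_val (S : pure_sig) (C : sort S -> Type)
    (G : option (sort S)) : ty_val C (ty_of_context G) -> context C G :=
  match G with
  | None => fun x => x
  | Some _ => fun x => x
  end.

Section ExcInterpretation.

Variables (S : pure_spec) (M : pure_model S) (I : Type) (P : I -> sort S).
Variables (Exc : Type) (t : forall i : I, carrier M (P i) -> Exc).
Variable V : ty S -> ty S -> Type.
Variable v : forall X Y : ty S, V X Y ->
  hom Exc Propagator (ty_val (carrier M) X) (ty_val (carrier M) Y).

Let N := exc_interpretation t v.

Lemma eval_expr_of_term (G : option (sort S)) (s : sort S) (u : term G s)
    (x : ty_val (carrier M) (ty_of_context G)) :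
  eval N (expr_of_term P V u) x =
  term_eval (@cst_val S M) (@op_val S M) u (context_of_val x).
Proof.
induction u as [s | G s c | G s s' f u IHu]; simpl.
- reflexivity.
- reflexivity.
- now rewrite <- IHu.
Qed.

Lemma exc_interpretation_is_model :
  (forall i a b, t (i:=i) a = t b -> a = b) ->
  (forall i j (a : carrier M (P i)) (b : carrier M (P j)),
     t a = t b -> i = j) ->
  is_model N.
Proof.
intros t_inj t_disj s X Y f g [G s' u w ax | i | i j ne]; simpl.
(* Both sides are promoted from propagators, so they agree on exceptions by construction. *)
- intros [x | e]; simpl; [| reflexivity].
  unfold ppg_of_pure; rewrite !eval_expr_of_term.
  f_equal; now apply pure_axiom_val.
(* A weak equation tests ordinary values only; tagging sends [a] to [inr (t i a)], so the left side
   computes to [untag t i (t i a)]. *)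
- intros a; exact (untag_same t_inj a).
- intros b; exact (untag_other t_disj b ne).
Qed.

Lemma eval_ehandlers (Y : ty S) (gs : list (eclause P V Y)) (e : Exc) :
  eval N (ehandlers gs) (inr e) =
  handlers t (map (clause_val N (Y:=Y)) gs) e.
Proof.
(* The exception stays general because the later clauses receive the [e'] returned by [untag]. *)
revert e; induction gs as [| [i g] gs IHgs]; intros e; simpl.
- reflexivity.
- destruct (untag t i e) as [a | e']; simpl; [reflexivity | apply IHgs].
Qed.

Lemma eval_etry (X Y : ty S) (f : expr P V Propagator X Y)
    (gs : list (eclause P V Y)) (x : ty_val (carrier M) X) :
  eval N (etry f gs) x =
  handle t (eval N f) (map (clause_val N (Y:=Y)) gs) x.
Proof.
unfold handle; simpl; unfold hom_natural; simpl.
(* An ordinary result bypasses the handlers; an exception enters their chain. *)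
destruct (eval N f x) as [y | e]; simpl; [reflexivity | apply eval_ehandlers].
Qed.

End ExcInterpretation.

Theorem theorem1 (S : pure_spec) (M : pure_model S)
    (I : Type) (P : I -> sort S) (Exc : Type)
    (t : forall i : I, carrier M (P i) -> Exc)
    (t_inj : forall (i : I) (a b : carrier M (P i)), t i a = t i b -> a = b)
    (t_disj : forall (i j : I) (a : carrier M (P i)) (b : carrier M (P j)),
       t i a = t j b -> i = j)
    (t_cover : forall e : Exc, exists (i : I) (a : carrier M (P i)), t i a = e)
    (V : ty S -> ty S -> Type)
    (v : forall X Y : ty S, V X Y ->
       hom Exc Propagator (ty_val (carrier M) X) (ty_val (carrier M) Y)) :
  let N := exc_interpretation t v in
  is_model N /\
  (forall (i : I) (Y : ty S) (a : carrier M (P i)),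
     eval N (ethrow P V i Y) a = throw t i (ty_val (carrier M) Y) a) /\
  (forall (X Y : ty S) (f : expr P V Propagator X Y)
          (gs : list (eclause P V Y)) (x : ty_val (carrier M) X),
     gs <> nil ->
     eval N (etry f gs) x = handle t (eval N f) (map (clause_val N (Y:=Y)) gs) x).
Proof.
intros N; split; [| split].
- now apply exc_interpretation_is_model.
(* The tag always yields an exception, which the promoted empty function propagates unchanged. *)
- reflexivity.
- intros X Y f gs x _; apply eval_etry.
Qed.
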